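(* Let $\mathcal{P}\colon \mathbb{C}\hookrightarrow\mathbb{E}$ be a projective cover of an exact category $\mathbb{E}$. Then $\mathbb{E}$ is locally cartesian closed if and only if $\mathbb{C}$ has extensional dependent products.
   Context: A category is exact if it has finite limits, regular epis are stable under pullback, and every equivalence relation $(r_1,r_2)\colon R\hookrightarrow X\times X$ has a coequaliser $q$ of $r_1,r_2$ such that $r_1,r_2$ is a kernel pair of $q$. An object $P$ of a category is (regular) projective if every arrow $P\to B$ lifts along every regular epi $A\to B$. A projective cover of an exact category $\mathbb{E}$ is (the inclusion $\mathcal{P}$ of) a full subcategory $\mathcal{P}\colon\mathbb{C}\hookrightarrow\mathbb{E}$ such that $\mathcal{P}X$ is projective in $\mathbb{E}$ for every $X$ in $\mathbb{C}$, and for every $A$ in $\mathbb{E}$ there are $X$ in $\mathbb{C}$ and a regular epi $\mathcal{P}X\to A$. In this situation $\mathbb{C}$ has weak finite limits, so the notions below make sense in $\mathbb{C}$. A weak limit is defined as a limit but without requiring uniqueness of the induced arrow. Let $\mathbb{C}$ have weak finite limits. A pseudo equivalence relation $x_1,x_2\colon\bar X\rightrightarrows X$ consists of arrows $x_1,x_2\colon\bar X\to X$ for which there are $\rho\colon X\to\bar X$, $\sigma\colon\bar X\to\bar X$ and $\tau\colon W\to\bar X$, where $W$ with $p_1,p_2\colon W\to\bar X$ is a weak pullback of $x_2$ and $x_1$ (so $x_2p_1=x_1p_2$), with $x_1\rho=x_2\rho=\mathrm{id}_X$, $x_1\sigma=x_2$, $x_2\sigma=x_1$, $x_1\tau=x_1p_1$,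 $x_2\tau=x_2p_2$. A weak kernel pair of a span $X\xleftarrow{p_1}V\xrightarrow{p_2}W$ is a pair $v_1,v_2\colon\bar V\to V$ with $p_iv_1=p_iv_2$ for $i=1,2$, weakly universal with this property (it is a pseudo equivalence relation). If $X\xleftarrow{p_1}V\xrightarrow{p_2}W$ is a weak pullback of a cospan $X\to Z\leftarrow W$ and $y_1,y_2\colon\bar Y\rightrightarrows Y$ is a pseudo equivalence relation, an arrow $f\colon V\to Y$ preserves (pullback) projections with respect to $y_1,y_2$ if, for a weak kernel pair $v_1,v_2\colon\bar V\to V$ of $p_1,p_2$, there is $\bar f\colon\bar V\to\bar Y$ with $y_i\bar f=fv_i$ for $i=1,2$. Extensional dependent product: let $y_1,y_2\colon\bar Y\rightrightarrows Y$ be a pseudo equivalence relation and $Y\xrightarrow{g}X\xrightarrow{f}Z$ arrows with $gy_1=gy_2$. Consider data $D=(W,w,V,p_1,p_2,e)$ where $w\colon W\to Z$, $X\xleftarrow{p_1}V\xrightarrow{p_2}W$ is a weak pullback of $f$ and $w$, and $e\colon V\to Y$ preserves projections with respect to $y_1,y_2$ and satisfies $ge=p_1$. An extensional dependent product of $g$ along $f$ with respect to $y_1,y_2$ is such a $D$ with the property that for every other such $D'=(W',w',V',p_1',p_2',e')$ there are $h\colon W'\to W$ and $k\colon V'\to V$ with $wh=w'$, $p_1k=p_1'$, $p_2k=hp_2'$, $ek=e'$. $\mathbb{C}$ has extensional dependent products if one exists for all such $y_1,y_2$ and $g,f$. *)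

(* Defs.v *)
From Stdlib Require Import FinFun ProofIrrelevance.

Set Implicit Arguments.
Unset Strict Implicit.
Unset Printing Implicit Defensive.

Declare Scope cat_scope.
Delimit Scope cat_scope with cat.
Local Open Scope cat_scope.

(** * Categories, functors, slices and full subcategories *)

Record Category := MkCategory {
  Ob :> Type;
  Hom : Ob -> Ob -> Type;
  id : forall X, Hom X X;
  comp : forall X Y Z, Hom Y Z -> Hom X Y -> Hom X Z;
  comp_id_l : forall X Y (f : Hom X Y), comp (id Y) f = f;
  comp_id_r : forall X Y (f : Hom X Y), comp f (id X) = f;
  comp_assoc : forall X Y Z T (h : Hom Z T) (g : Hom Y Z) (f : Hom X Y),
    comp h (comp g f) = comp (comp h g) f
}.

Arguments Hom {c} X Y.
Arguments id {c} X.
Arguments comp {c X Y Z} g f.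
Arguments comp_id_l {c X Y} f.
Arguments comp_id_r {c X Y} f.
Arguments comp_assoc {c X Y Z T} h g f.

Notation "g ∘ f" := (comp g f) (at level 40, left associativity) : cat_scope.

Record Functor (J C : Category) := MkFunctor {
  fob :> J -> C;
  fmor : forall i j : J, Hom i j -> Hom (fob i) (fob j);
  fmor_id : forall i : J, fmor (id i) = id (fob i);
  fmor_comp : forall (i j k : J) (b : Hom j k) (a : Hom i j),
    fmor (b ∘ a) = fmor b ∘ fmor a
}.

Arguments fmor {J C} f {i j} a.

Definition full_subcategory (E : Category) (P : E -> Prop) : Category :=
  {| Ob := {X : E | P X};
     Hom X Y := @Hom E (proj1_sig X) (proj1_sig Y);
     id X := id (proj1_sig X);
     comp X Y Z g f := g ∘ f;
     comp_id_l X Y f := comp_id_l f;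
     comp_id_r X Y f := comp_id_r f;
     comp_assoc X Y Z T h g f := comp_assoc h g f |}.

Section Slice.
Variables (E : Category) (I : E).

Record slice_ob := MkSliceOb {
  slice_dom : E;
  slice_arr : Hom slice_dom I
}.

Definition slice_hom (A B : slice_ob) :=
  {h : Hom (slice_dom A) (slice_dom B) | slice_arr B ∘ h = slice_arr A}.

Lemma slice_hom_eq (A B : slice_ob) (h k : slice_hom A B) :
  proj1_sig h = proj1_sig k -> h = k.
Proof.
destruct h as [h Hh], k as [k Hk]; simpl; intros e.
now apply subset_eq_compat.
Qed.

Definition slice_id (A : slice_ob) : slice_hom A A :=
  exist _ (id (slice_dom A)) (comp_id_r (slice_arr A)).

Lemma slice_comp_proof (A B C : slice_ob)
    (k : slice_hom B C) (h : slice_hom A B) :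
  slice_arr C ∘ (proj1_sig k ∘ proj1_sig h) = slice_arr A.
Proof.
destruct k as [k Hk], h as [h Hh]; simpl.
now rewrite comp_assoc, Hk, Hh.
Qed.

Definition slice_comp (A B C : slice_ob)
    (k : slice_hom B C) (h : slice_hom A B) : slice_hom A C :=
  exist _ (proj1_sig k ∘ proj1_sig h) (slice_comp_proof k h).

Lemma slice_comp_id_l (A B : slice_ob) (f : slice_hom A B) :
  slice_comp (slice_id B) f = f.
Proof. apply slice_hom_eq, comp_id_l. Qed.

Lemma slice_comp_id_r (A B : slice_ob) (f : slice_hom A B) :
  slice_comp f (slice_id A) = f.
Proof. apply slice_hom_eq, comp_id_r. Qed.

Lemma slice_comp_assoc (A B C D : slice_ob)
    (h : slice_hom C D) (g : slice_hom B C) (f : slice_hom A B) :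
  slice_comp h (slice_comp g f) = slice_comp (slice_comp h g) f.
Proof. apply slice_hom_eq, comp_assoc. Qed.

Definition slice : Category :=
  {| Ob := slice_ob;
     Hom := slice_hom;
     id := slice_id;
     comp := slice_comp;
     comp_id_l := slice_comp_id_l;
     comp_id_r := slice_comp_id_r;
     comp_assoc := slice_comp_assoc |}.

End Slice.

(** * Limits and local cartesian closure *)

Definition finite_category (J : Category) : Prop :=
  Finite J /\ forall i j : J, Finite (Hom i j).

Definition is_cone (J C : Category) (D : Functor J C) (L : C)
    (p : forall i : J, Hom L (D i)) : Prop :=
  forall (i j : J) (a : Hom i j), fmor D a ∘ p i = p j.

Definition is_limit (J C : Category) (D : Functor J C) (L : C)
    (p : forall i : J, Hom L (D i)) : Prop :=
  is_cone p /\
  forall (T : C) (t : forall i : J, Hom T (D i)), is_cone t ->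
    exists! u : Hom T L, forall i : J, p i ∘ u = t i.

Definition has_finite_limits (C : Category) : Prop :=
  forall J : Category, finite_category J -> forall D : Functor J C,
    exists (L : C) (p : forall i : J, Hom L (D i)), is_limit p.

Definition is_terminal (C : Category) (T : C) : Prop :=
  forall X : C, exists! _ : Hom X T, True.

Definition is_product (C : Category) (A B P : C)
    (p1 : Hom P A) (p2 : Hom P B) : Prop :=
  forall (T : C) (t1 : Hom T A) (t2 : Hom T B),
    exists! u : Hom T P, p1 ∘ u = t1 /\ p2 ∘ u = t2.

Definition is_pullback (C : Category) (X W Z V : C)
    (f : Hom X Z) (w : Hom W Z) (p1 : Hom V X) (p2 : Hom V W) : Prop :=
  f ∘ p1 = w ∘ p2 /\
  forall (T : C) (t1 : Hom T X) (t2 : Hom T W), f ∘ t1 = w ∘ t2 ->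
    exists! u : Hom T V, p1 ∘ u = t1 /\ p2 ∘ u = t2.

(* [P] with [p1], [p2] is a product [F * A], and [ev : F * A -> B] is
   couniversal: each [g : Q -> B], with [Q] a product [T * A], is
   [ev ∘ (h * id)] for a unique [h : T -> F]; here [u] is [h * id]. *)
Definition is_exponential (C : Category) (A B F P : C)
    (p1 : Hom P F) (p2 : Hom P A) (ev : Hom P B) : Prop :=
  is_product p1 p2 /\
  forall (T Q : C) (q1 : Hom Q T) (q2 : Hom Q A), is_product q1 q2 ->
  forall g : Hom Q B,
    exists! h : Hom T F,
      exists u : Hom Q P, p1 ∘ u = h ∘ q1 /\ p2 ∘ u = q2 /\ ev ∘ u = g.

Definition cartesian_closed (C : Category) : Prop :=
  (exists T : C, is_terminal T) /\
  (forall A B : C,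
     exists (P : C) (p1 : Hom P A) (p2 : Hom P B), is_product p1 p2) /\
  (forall A B : C,
     exists (F P : C) (p1 : Hom P F) (p2 : Hom P A) (ev : Hom P B),
       is_exponential p1 p2 ev).

Definition locally_cartesian_closed (E : Category) : Prop :=
  forall I : E, cartesian_closed (slice I).

(** * Exact categories and projective covers *)

Definition is_coequalizer (C : Category) (R X Q : C)
    (r1 r2 : Hom R X) (q : Hom X Q) : Prop :=
  q ∘ r1 = q ∘ r2 /\
  forall (T : C) (t : Hom X T), t ∘ r1 = t ∘ r2 ->
    exists! u : Hom Q T, u ∘ q = t.

Definition regular_epi (C : Category) (A B : C) (q : Hom A B) : Prop :=
  exists (R : C) (r1 r2 : Hom R A), is_coequalizer r1 r2 q.

Definition jointly_monic (C : Category) (R X Y : C)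
    (r1 : Hom R X) (r2 : Hom R Y) : Prop :=
  forall (T : C) (s t : Hom T R), r1 ∘ s = r1 ∘ t -> r2 ∘ s = r2 ∘ t -> s = t.

Definition equivalence_relation (C : Category) (R X : C)
    (r1 r2 : Hom R X) : Prop :=
  jointly_monic r1 r2 /\
  (exists rho : Hom X R, r1 ∘ rho = id X /\ r2 ∘ rho = id X) /\
  (exists sigma : Hom R R, r1 ∘ sigma = r2 /\ r2 ∘ sigma = r1) /\
  (exists (W : C) (p1 p2 : Hom W R) (tau : Hom W R),
     is_pullback r2 r1 p1 p2 /\
     r1 ∘ tau = r1 ∘ p1 /\ r2 ∘ tau = r2 ∘ p2).

Definition exact (E : Category) : Prop :=
  has_finite_limits E /\
  (forall (X W Z V : E) (f : Hom X Z) (w : Hom W Z)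
          (p1 : Hom V X) (p2 : Hom V W),
     is_pullback f w p1 p2 -> regular_epi f -> regular_epi p2) /\
  (forall (R X : E) (r1 r2 : Hom R X), equivalence_relation r1 r2 ->
     exists (Q : E) (q : Hom X Q),
       is_coequalizer r1 r2 q /\ is_pullback q q r1 r2).

Definition projective (E : Category) (P : E) : Prop :=
  forall (A B : E) (q : Hom A B), regular_epi q ->
  forall b : Hom P B, exists a : Hom P A, q ∘ a = b.

(* The full subcategory is given by its class [P] of objects. *)
Definition projective_cover (E : Category) (P : E -> Prop) : Prop :=
  (forall X : E, P X -> projective X) /\
  (forall A : E, exists X : E, P X /\ exists q : Hom X A, regular_epi q).

(** * Weak limits and extensional dependent products *)

Definition is_weak_pullback (C : Category) (X W Z V : C)
    (f : Hom X Z) (w : Hom W Z) (p1 : Hom V X) (p2 : Hom V W) : Prop :=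
  f ∘ p1 = w ∘ p2 /\
  forall (T : C) (t1 : Hom T X) (t2 : Hom T W), f ∘ t1 = w ∘ t2 ->
    exists u : Hom T V, p1 ∘ u = t1 /\ p2 ∘ u = t2.

Definition is_weak_kernel_pair (C : Category) (X V W K : C)
    (p1 : Hom V X) (p2 : Hom V W) (v1 v2 : Hom K V) : Prop :=
  p1 ∘ v1 = p1 ∘ v2 /\ p2 ∘ v1 = p2 ∘ v2 /\
  forall (T : C) (t1 t2 : Hom T V),
    p1 ∘ t1 = p1 ∘ t2 -> p2 ∘ t1 = p2 ∘ t2 ->
    exists u : Hom T K, v1 ∘ u = t1 /\ v2 ∘ u = t2.

Definition pseudo_equivalence_relation (C : Category) (X' X : C)
    (x1 x2 : Hom X' X) : Prop :=
  (exists rho : Hom X X', x1 ∘ rho = id X /\ x2 ∘ rho = id X) /\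
  (exists sigma : Hom X' X', x1 ∘ sigma = x2 /\ x2 ∘ sigma = x1) /\
  (exists (W : C) (p1 p2 : Hom W X') (tau : Hom W X'),
     is_weak_pullback x2 x1 p1 p2 /\
     x1 ∘ tau = x1 ∘ p1 /\ x2 ∘ tau = x2 ∘ p2).

(* Weak kernel pairs of a span factor through one another, so the choice of
   the weak kernel pair is immaterial. *)
Definition preserves_projections (C : Category) (X V W Y Y' : C)
    (p1 : Hom V X) (p2 : Hom V W) (y1 y2 : Hom Y' Y) (f : Hom V Y) : Prop :=
  exists (V' : C) (v1 v2 : Hom V' V),
    is_weak_kernel_pair p1 p2 v1 v2 /\
    exists f' : Hom V' Y', y1 ∘ f' = f ∘ v1 /\ y2 ∘ f' = f ∘ v2.

Record edp_data (C : Category) (Y' Y X Z : C)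
    (y1 y2 : Hom Y' Y) (g : Hom Y X) (f : Hom X Z) := MkEdpData {
  edp_W : C;
  edp_w : Hom edp_W Z;
  edp_V : C;
  edp_p1 : Hom edp_V X;
  edp_p2 : Hom edp_V edp_W;
  edp_e : Hom edp_V Y;
  edp_weak_pullback : is_weak_pullback f edp_w edp_p1 edp_p2;
  edp_preserves : preserves_projections edp_p1 edp_p2 y1 y2 edp_e;
  edp_section : g ∘ edp_e = edp_p1
}.

Definition is_extensional_dependent_product (C : Category) (Y' Y X Z : C)
    (y1 y2 : Hom Y' Y) (g : Hom Y X) (f : Hom X Z)
    (D : edp_data y1 y2 g f) : Prop :=
  forall D' : edp_data y1 y2 g f,
    exists (h : Hom (edp_W D') (edp_W D)) (k : Hom (edp_V D') (edp_V D)),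
      edp_w D ∘ h = edp_w D' /\
      edp_p1 D ∘ k = edp_p1 D' /\
      edp_p2 D ∘ k = h ∘ edp_p2 D' /\
      edp_e D ∘ k = edp_e D'.

Definition has_extensional_dependent_products (C : Category) : Prop :=
  forall (Y' Y X Z : C) (y1 y2 : Hom Y' Y) (g : Hom Y X) (f : Hom X Z),
    pseudo_equivalence_relation y1 y2 -> g ∘ y1 = g ∘ y2 ->
    exists D : edp_data y1 y2 g f, is_extensional_dependent_product D.

(* Main.v *)
Require Import Defs.
From Stdlib Require Import FinFun Bool List.

Set Implicit Arguments.
Unset Strict Implicit.
Unset Printing Implicit Defensive.

(** Points, i.e. arrows from objects of [P], detect everything in [E]: two
arrows that agree on points are equal, and along an arrow that is surjective on
points (a "cover") every arrow that is compatible with it on points descends.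
So a span whose relation on points is an equivalence has an effective quotient.

Local cartesian closure is the existence of dependent products. Given these, an
extensional dependent product of [g] with respect to [y1], [y2] is obtained from the
quotient [q : Y -> A] by [y1], [y2] and the dependent product [D] of [A -> X] along [f]:
cover [D] by [W], and take for [V] a cover of the pullback of [q] along the
evaluation [X * W -> A] (product over [Z]); covering [X * W] alone would not
suffice to have [e ∘ k = e'] on the nose.

Conversely, extensional dependent products with respect to kernel pairs are
dependent products in [E] that are weakly universal for points. The fibre and
the base may be replaced by covers: for the fibre, the condition that a section
over a cover of [X] descends to [X] is itself imposed by a weak dependent
product, of an equalizer. One more of these, again of an equalizer, classifies
the pairs of points of the weak dependent product [W] that carry the same
section, and the quotient of [W] by this relation is the dependent product. *)

Local Open Scope cat_scope.

(** * Finite limits *)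

Section Reassociation.
Variable C : Category.

(** In a composite nested to the right, the left-hand side of an equation is no longer a subterm
    when a further arrow [x] stands behind it; these variants carry [x] along. *)
Lemma reassoc2 (X Y Z : C) (g : Hom Y Z) (f : Hom X Y) (k : Hom X Z) :
  g ∘ f = k -> forall T (x : Hom T X), g ∘ (f ∘ x) = k ∘ x.
Proof. now intros <- T x; rewrite comp_assoc. Qed.

Lemma reassoc3 (X Y Z U : C) (h : Hom Z U) (g : Hom Y Z) (f : Hom X Y)
    (k : Hom X U) :
  h ∘ (g ∘ f) = k -> forall T (x : Hom T X), h ∘ (g ∘ (f ∘ x)) = k ∘ x.
Proof. now intros <- T x; rewrite !comp_assoc. Qed.

Lemma reassoc4 (X Y Z U S : C) (i : Hom U S) (h : Hom Z U) (g : Hom Y Z)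
    (f : Hom X Y) (k : Hom X S) :
  i ∘ (h ∘ (g ∘ f)) = k ->
  forall T (x : Hom T X), i ∘ (h ∘ (g ∘ (f ∘ x))) = k ∘ x.
Proof. now intros <- T x; rewrite !comp_assoc. Qed.

Lemma reassoc5 (X Y Z U S R : C) (j : Hom S R) (i : Hom U S) (h : Hom Z U)
    (g : Hom Y Z) (f : Hom X Y) (k : Hom X R) :
  j ∘ (i ∘ (h ∘ (g ∘ f))) = k ->
  forall T (x : Hom T X), j ∘ (i ∘ (h ∘ (g ∘ (f ∘ x)))) = k ∘ x.
Proof. now intros <- T x; rewrite !comp_assoc. Qed.

End Reassociation.

Ltac nrm := rewrite <- ?comp_assoc, ?comp_id_l, ?comp_id_r.

(* Rewrites with an equation between arrows, modulo associativity. *)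
Ltac rw1 H :=
  let e := fresh "e" in
  pose proof H as e; rewrite <- ?comp_assoc in e; nrm;
  let step := (first [rewrite (reassoc5 e) | rewrite (reassoc4 e)
                     | rewrite (reassoc3 e) | rewrite (reassoc2 e)
                     | rewrite e]; nrm) in
  step; do 3 try step; clear e.

Tactic Notation "rw" constr(a) := rw1 a.
Tactic Notation "rw" constr(a) "," constr(b) := rw1 a; rw1 b.
Tactic Notation "rw" constr(a) "," constr(b) "," constr(c) :=
  rw1 a; rw1 b; rw1 c.
Tactic Notation "rw" constr(a) "," constr(b) "," constr(c) "," constr(d) :=
  rw1 a; rw1 b; rw1 c; rw1 d.
Tactic Notation "rw" constr(a) "," constr(b) "," constr(c) "," constr(d)
    "," constr(e) :=
  rw1 a; rw1 b; rw1 c; rw1 d; rw1 e.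

Ltac cat :=
  nrm; do 4 try match goal with
  | H : @eq (Hom _ _) _ _ |- _ => progress rw1 H
  end; reflexivity.

(** * Pullbacks, equalizers and kernel pairs from finite limits *)

Section Pullbacks.
Variable C : Category.

Lemma pullback_comm (X W Z V : C) (f : Hom X Z) (w : Hom W Z)
    (p1 : Hom V X) (p2 : Hom V W) :
  is_pullback f w p1 p2 -> f ∘ p1 = w ∘ p2.
Proof. now intros [H _]. Qed.

Lemma pullback_lift (X W Z V : C) (f : Hom X Z) (w : Hom W Z)
    (p1 : Hom V X) (p2 : Hom V W) :
  is_pullback f w p1 p2 ->
  forall T (t1 : Hom T X) (t2 : Hom T W), f ∘ t1 = w ∘ t2 ->
  exists u : Hom T V, p1 ∘ u = t1 /\ p2 ∘ u = t2.
Proof. intros [_ H] T t1 t2 e; destruct (H T t1 t2 e) as [u [Hu _]]; eauto. Qed.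

Lemma pullback_ext (X W Z V : C) (f : Hom X Z) (w : Hom W Z)
    (p1 : Hom V X) (p2 : Hom V W) :
  is_pullback f w p1 p2 ->
  forall T (u v : Hom T V), p1 ∘ u = p1 ∘ v -> p2 ∘ u = p2 ∘ v -> u = v.
Proof.
intros [e H] T u v H1 H2.
destruct (H T (p1 ∘ v) (p2 ∘ v)) as [m [_ Hm]].
- now rw e.
- transitivity m; [symmetry|]; apply Hm; auto.
Qed.

Lemma pullback_intro (X W Z V : C) (f : Hom X Z) (w : Hom W Z)
    (p1 : Hom V X) (p2 : Hom V W) :
  f ∘ p1 = w ∘ p2 ->
  (forall T (t1 : Hom T X) (t2 : Hom T W), f ∘ t1 = w ∘ t2 ->
   exists u : Hom T V, p1 ∘ u = t1 /\ p2 ∘ u = t2) ->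
  (forall T (u v : Hom T V), p1 ∘ u = p1 ∘ v -> p2 ∘ u = p2 ∘ v -> u = v) ->
  is_pullback f w p1 p2.
Proof.
intros e H U; split; [exact e|]; intros T t1 t2 ht.
destruct (H T t1 t2 ht) as [u [H1 H2]]; exists u; split; [auto|].
intros u' [H1' H2']; apply U; congruence.
Qed.

(* The shape of two cospans with the same sources: its limits yield pullbacks,
   equalizers and kernel pairs of spans. *)
Definition square_le (i j : bool * bool) : bool :=
  if fst i then fst j && eqb (snd i) (snd j)
  else fst j || eqb (snd i) (snd j).

Lemma square_le_refl i : square_le i i = true.
Proof. now destruct i as [[|] [|]]. Qed.

Lemma square_le_trans i j k :
  square_le j k = true -> square_le i j = true -> square_le i k = true.
Proof. now destruct i as [[|] [|]], j as [[|] [|]], k as [[|] [|]]. Qed.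

(** Arrows are equations in [bool], hence unique. Pairs starting with [false] are the sources, the
    others the targets. *)
Definition square_category : Category.
Proof.
refine {| Ob := bool * bool; Hom i j := square_le i j = true;
          id := square_le_refl; comp := square_le_trans |};
  intros; apply (Eqdep_dec.UIP_dec bool_dec).
Defined.

Lemma square_category_finite : finite_category square_category.
Proof.
split.
- exists ((true, true) :: (true, false) :: (false, true) :: (false, false)
    :: nil)%list.
  now intros [[|] [|]]; simpl; auto.
- intros i j; simpl; destruct (square_le i j) eqn:e.
  + exists (eq_refl :: nil)%list; intros a; left.
    apply (Eqdep_dec.UIP_dec bool_dec).
  + exists nil; discriminate.
Qed.
Section SquareFunctor.
Variables (X W Z1 Z2 : C).
Variables (f1 : Hom X Z1) (f2 : Hom X Z2) (w1 : Hom W Z1) (w2 : Hom W Z2).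

Definition square_ob (i : bool * bool) : C :=
  match i with
  | (false, false) => X
  | (false, true) => W
  | (true, false) => Z1
  | (true, true) => Z2
  end.

Definition square_mor (i j : bool * bool) :
  square_le i j = true -> Hom (square_ob i) (square_ob j) :=
  match i, j return square_le i j = true -> Hom (square_ob i) (square_ob j) with
  | (false, false), (false, false) => fun _ => id X
  | (false, true), (false, true) => fun _ => id W
  | (true, false), (true, false) => fun _ => id Z1
  | (true, true), (true, true) => fun _ => id Z2
  | (false, false), (true, false) => fun _ => f1
  | (false, false), (true, true) => fun _ => f2
  | (false, true), (true, false) => fun _ => w1
  | (false, true), (true, true) => fun _ => w2
  | _, _ => fun e => False_rect _ (diff_false_true e)
  end.

Definition square_functor : Functor square_category C.
Proof.
refine (@MkFunctor square_category C square_ob square_mor _ _).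
- now intros [[|] [|]].
- intros [[|] [|]] [[|] [|]] [[|] [|]] b a; simpl in *; try discriminate;
    now rewrite ?comp_id_l, ?comp_id_r.
Defined.
End SquareFunctor.

Hypothesis C_lim : has_finite_limits C.

Lemma joint_pullback_exists (X W Z1 Z2 : C)
    (f1 : Hom X Z1) (f2 : Hom X Z2) (w1 : Hom W Z1) (w2 : Hom W Z2) :
  exists (V : C) (p1 : Hom V X) (p2 : Hom V W),
    f1 ∘ p1 = w1 ∘ p2 /\ f2 ∘ p1 = w2 ∘ p2 /\ jointly_monic p1 p2 /\
    forall T (t1 : Hom T X) (t2 : Hom T W),
      f1 ∘ t1 = w1 ∘ t2 -> f2 ∘ t1 = w2 ∘ t2 ->
      exists u : Hom T V, p1 ∘ u = t1 /\ p2 ∘ u = t2.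
Proof.
destruct (C_lim square_category_finite (square_functor f1 f2 w1 w2))
  as [V [p [p_cone p_univ]]].
assert (e1 : f1 ∘ p (false, false) = w1 ∘ p (false, true)).
{ transitivity (p (true, false));
    [exact (p_cone (false, false) (true, false) eq_refl)
    |symmetry; exact (p_cone (false, true) (true, false) eq_refl)]. }
assert (e2 : f2 ∘ p (false, false) = w2 ∘ p (false, true)).
{ transitivity (p (true, true));
    [exact (p_cone (false, false) (true, true) eq_refl)
    |symmetry; exact (p_cone (false, true) (true, true) eq_refl)]. }
assert (univ : forall T (t1 : Hom T X) (t2 : Hom T W),
  f1 ∘ t1 = w1 ∘ t2 -> f2 ∘ t1 = w2 ∘ t2 ->
  exists! u : Hom T V, p (false, false) ∘ u = t1 /\ p (false, true) ∘ u = t2).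
{ intros T t1 t2 h1 h2.
  pose (t := fun i : bool * bool =>
    match i return Hom T (square_ob X W Z1 Z2 i) with
    | (false, false) => t1
    | (false, true) => t2
    | (true, false) => f1 ∘ t1
    | (true, true) => f2 ∘ t1
    end).
  destruct (p_univ T t) as [u [hu u_uniq]].
  - intros [[|] [|]] [[|] [|]] a; simpl in *; try discriminate;
      now rewrite ?comp_id_l.
  - exists u; split; [exact (conj (hu (false, false)) (hu (false, true)))|].
    intros v [v1 v2]; apply u_uniq.
    pose proof (p_cone (false, false) (true, false) eq_refl) as c1.
    pose proof (p_cone (false, false) (true, true) eq_refl) as c2.
    simpl in c1, c2.
    intros [[|] [|]]; simpl; trivial.
    + rewrite <- v1, <- c2; symmetry; apply comp_assoc.
    + rewrite <- v1, <- c1; symmetry; apply comp_assoc. }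
exists V, (p (false, false)), (p (false, true)); repeat split; trivial.
- intros T s t hs ht.
  destruct (univ T (p (false, false) ∘ t) (p (false, true) ∘ t)) as [u [_ uu]].
  + now rw e1.
  + now rw e2.
  + transitivity u; [symmetry|]; apply uu; auto.
- intros T t1 t2 h1 h2.
  destruct (univ T t1 t2 h1 h2) as [u [hu _]]; eauto.
Qed.

Lemma pullback_exists (X W Z : C) (f : Hom X Z) (w : Hom W Z) :
  exists (V : C) (p1 : Hom V X) (p2 : Hom V W), is_pullback f w p1 p2.
Proof.
destruct (joint_pullback_exists f f w w) as [V [p1 [p2 [e [_ [U H]]]]]].
exists V, p1, p2; apply pullback_intro; auto.
Qed.

Lemma span_kernel_exists (V X W : C) (p1 : Hom V X) (p2 : Hom V W) :
  exists (K : C) (k1 k2 : Hom K V),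
    p1 ∘ k1 = p1 ∘ k2 /\ p2 ∘ k1 = p2 ∘ k2 /\ jointly_monic k1 k2 /\
    forall T (t1 t2 : Hom T V), p1 ∘ t1 = p1 ∘ t2 -> p2 ∘ t1 = p2 ∘ t2 ->
      exists u : Hom T K, k1 ∘ u = t1 /\ k2 ∘ u = t2.
Proof. exact (joint_pullback_exists p1 p2 p1 p2). Qed.

Lemma equalizer_exists (X Y : C) (f g : Hom X Y) :
  exists (M : C) (i : Hom M X),
    f ∘ i = g ∘ i /\
    (forall T (s t : Hom T M), i ∘ s = i ∘ t -> s = t) /\
    forall T (t : Hom T X), f ∘ t = g ∘ t -> exists u : Hom T M, i ∘ u = t.
Proof.
(* The second projection [y] equals both [f ∘ i] and [g ∘ i]. *)
destruct (joint_pullback_exists f g (id Y) (id Y))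
  as [M [i [y [e1 [e2 [U H]]]]]].
rewrite comp_id_l in e1, e2.
exists M, i; split; [congruence|split].
- intros T s t e; apply U; trivial.
  now rw (eq_sym e1); rewrite e.
- intros T t e; destruct (H T t (f ∘ t)) as [u [hu _]]; rewrite ?comp_id_l; eauto.
Qed.

End Pullbacks.

(** * Covers and quotients *)

Section Covers.
Variables (E : Category) (P : E -> Prop).
Hypotheses (E_exact : exact E) (P_cover : projective_cover P).

(** Stands in for regular epis: these are covers because objects of [P] are projective, and
    [cover_descend] recovers their descent property. *)
Definition cover (A B : E) (q : Hom A B) : Prop :=
  forall T, P T -> forall b : Hom T B, exists a : Hom T A, q ∘ a = b.

Lemma cover_comp (A B D : E) (r : Hom B D) (q : Hom A B) :
  cover r -> cover q -> cover (r ∘ q).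
Proof.
intros hr hq T PT d; destruct (hr T PT d) as [b <-].
destruct (hq T PT b) as [a <-]; exists a; symmetry; apply comp_assoc.
Qed.

Lemma cover_exists (A : E) : exists (X : E) (q : Hom X A), P X /\ cover q.
Proof.
destruct P_cover as [proj enough]; destruct (enough A) as [X [PX [q hq]]].
exists X, q; split; [exact PX|].
intros T PT b; exact (proj T PT X A q hq b).
Qed.

(** A regular epi from an object of [P] onto [A] is one such point, and coequalizers are epi. *)
Lemma point_ext (A B : E) (f g : Hom A B) :
  (forall T, P T -> forall a : Hom T A, f ∘ a = g ∘ a) -> f = g.
Proof.
destruct P_cover as [_ enough]; destruct (enough A) as [X [PX [q hq]]].
intros H; destruct hq as [R [r1 [r2 [e U]]]].
destruct (U B (g ∘ q)) as [u [hu uu]].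
- now rw e.
- transitivity u; [symmetry|]; apply uu; auto.
Qed.

Lemma cover_epi (A B D : E) (q : Hom A B) (f g : Hom B D) :
  cover q -> f ∘ q = g ∘ q -> f = g.
Proof.
intros hq e; apply point_ext; intros T PT b.
destruct (hq T PT b) as [a <-]; now rw e.
Qed.

(** Lift a regular epi [c] from an object of [P] to [a] along [q]; by hypothesis [t ∘ a] identifies
    the pair that [c] coequalizes, so it factors through [c]. *)
Lemma cover_descend (A B D : E) (q : Hom A B) (t : Hom A D) :
  cover q ->
  (forall T, P T -> forall a1 a2 : Hom T A, q ∘ a1 = q ∘ a2 -> t ∘ a1 = t ∘ a2) ->
  exists u : Hom B D, u ∘ q = t.
Proof.
intros hq H.
destruct P_cover as [proj enough]; destruct (enough B) as [X [PX [c hc]]].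
destruct (hq X PX c) as [a ha].
assert (hcP := fun T PT => proj T PT X B c hc).
destruct hc as [R [r1 [r2 [e U]]]].
destruct (U D (t ∘ a)) as [u [hu _]].
- apply point_ext; intros T PT r; nrm; apply H; trivial.
  now rw ha, e.
- exists u; apply point_ext; intros T PT s.
  destruct (hcP T PT (q ∘ s)) as [x hx].
  nrm; rw (eq_sym hx), hu; apply H; trivial.
  now rw ha.
Qed.

(** Membership in a relation is local: a lift over a cover of [T] descends since joint monicity
    makes it compatible. *)
Lemma jointly_monic_factor (R X Y : E) (r1 : Hom R X) (r2 : Hom R Y) :
  jointly_monic r1 r2 -> forall T (x : Hom T X) (y : Hom T Y),
  (forall S, P S -> forall s : Hom S T,
     exists r : Hom S R, r1 ∘ r = x ∘ s /\ r2 ∘ r = y ∘ s) ->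
  exists r : Hom T R, r1 ∘ r = x /\ r2 ∘ r = y.
Proof.
intros jm T x y H; destruct (cover_exists T) as [T0 [c [PT0 hc]]].
destruct (H T0 PT0 c) as [r [h1 h2]].
destruct (@cover_descend _ _ _ c r hc) as [u hu].
- intros S PS a1 a2 e; apply jm.
  + now rw h1, e.
  + now rw h2, e.
- exists u; split; apply (cover_epi hc); nrm; now rw hu.
Qed.

(** The kernel pair of the span is an equivalence relation, and its effective quotient is the
    image. *)
Lemma image_exists (V X Y : E) (p1 : Hom V X) (p2 : Hom V Y) :
  exists (R : E) (q : Hom V R) (r1 : Hom R X) (r2 : Hom R Y),
    cover q /\ jointly_monic r1 r2 /\ r1 ∘ q = p1 /\ r2 ∘ q = p2.
Proof.
destruct E_exact as [E_lim [_ eff]].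
destruct (span_kernel_exists E_lim p1 p2) as [K [k1 [k2 [e1 [e2 [jm U]]]]]].
destruct (eff K V k1 k2) as [Q [q [qcoeq qpb]]].
{ split; [exact jm|split; [|split]].
  - destruct (U V (id V) (id V)) as [r hr]; eauto.
  - destruct (U K k2 k1) as [r hr]; eauto.
  - destruct (pullback_exists E_lim k2 k1) as [W [a [b pb]]].
    destruct (U W (k1 ∘ a) (k2 ∘ b)) as [r hr].
    + now rw e1, (pullback_comm pb), e1.
    + now rw e2, (pullback_comm pb), e2.
    + exists W, a, b, r; auto. }
assert (hq : cover q).
{ intros T PT; apply (proj1 P_cover T PT); exists K, k1, k2; exact qcoeq. }
destruct qcoeq as [qe qU].
destruct (qU _ p1 e1) as [r1 [h1 _]], (qU _ p2 e2) as [r2 [h2 _]].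
exists Q, q, r1, r2; repeat split; trivial.
(* Lifted to [V], two points with equal images in [X] and [Y] form a point of the kernel pair, so
   [q] identifies them. *)
intros T s t hs ht; apply point_ext; intros S PS x.
destruct (hq S PS (s ∘ x)) as [a ha], (hq S PS (t ∘ x)) as [b hb].
destruct (U S a b) as [k [<- <-]].
- rewrite <- h1; nrm; rw ha, hb; now rw hs.
- rewrite <- h2; nrm; rw ha, hb; now rw ht.
- rewrite <- ha, <- hb; now rw qe.
Qed.

Definition related (R X : E) (r1 r2 : Hom R X) (T : E) (x y : Hom T X) : Prop :=
  exists r : Hom T R, r1 ∘ r = x /\ r2 ∘ r = y.

(* On objects of [P] this amounts to being a pseudo equivalence relation. *)
Definition point_equivalence (R X : E) (r1 r2 : Hom R X) : Prop :=
  forall T, P T ->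
    (forall x : Hom T X, related r1 r2 x x) /\
    (forall x y : Hom T X, related r1 r2 x y -> related r1 r2 y x) /\
    (forall x y z : Hom T X,
       related r1 r2 x y -> related r1 r2 y z -> related r1 r2 x z).

(** The image of the span is jointly monic and, the projection to it being a cover, has the same
    relation on points; hence it is an equivalence relation with an effective quotient. *)
Lemma quotient_exists (R X : E) (r1 r2 : Hom R X) :
  point_equivalence r1 r2 ->
  exists (Q : E) (q : Hom X Q), cover q /\
    forall T, P T -> forall x y : Hom T X, q ∘ x = q ∘ y <-> related r1 r2 x y.
Proof.
intros req.
destruct (image_exists r1 r2) as [R' [c [s1 [s2 [hc [jm [h1 h2]]]]]]].
assert (relP : forall T, P T -> forall x y : Hom T X,
  related r1 r2 x y <-> related s1 s2 x y).
{ intros T PT x y; split.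
  - intros [r [<- <-]]; exists (c ∘ r); rw h1; now rw h2.
  - intros [s [<- <-]]; destruct (hc T PT s) as [r <-].
    exists r; rw h1; now rw h2. }
destruct E_exact as [E_lim [_ eff]].
destruct (eff R' X s1 s2) as [Q [q [qcoeq qpb]]].
{ split; [exact jm|split; [|split]].
  - apply (jointly_monic_factor jm); intros S PS s.
    apply relP; trivial; apply (proj1 (req S PS)).
  - apply (jointly_monic_factor jm); intros S PS s.
    apply relP; trivial; apply (proj1 (proj2 (req S PS))), relP; trivial.
    exists s; auto.
  - destruct (pullback_exists E_lim s2 s1) as [W [a [b pb]]].
    exists W, a, b.
    destruct (jointly_monic_factor jm (x := s1 ∘ a) (y := s2 ∘ b)) as [t ht].
    + intros S PS s; apply relP; trivial.
      apply (req S PS) with (s2 ∘ a ∘ s); apply relP; trivial.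
      * exists (a ∘ s); nrm; auto.
      * exists (b ∘ s); nrm; split; trivial; now rw (pullback_comm pb).
    + exists t; auto. }
exists Q, q; split.
- intros T PT; apply (proj1 P_cover T PT); exists R', s1, s2; exact qcoeq.
- intros T PT x y; rewrite relP by exact PT; split.
  + exact (@pullback_lift _ _ _ _ _ _ _ _ _ qpb T x y).
  + intros [s [<- <-]]; now rw (pullback_comm qpb).
Qed.

End Covers.

(** * Dependent products and local cartesian closure *)

(** [w] is the value at [a] of the right adjoint to pullback along [f], with [e] as counit;
    quantifying over all pullbacks avoids choosing a pullback functor. *)
Definition has_dependent_products (E : Category) : Prop :=
  forall (A X Z : E) (a : Hom A X) (f : Hom X Z),
  exists (W : E) (w : Hom W Z) (V : E) (p1 : Hom V X) (p2 : Hom V W)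
         (e : Hom V A),
    is_pullback f w p1 p2 /\ a ∘ e = p1 /\
    forall (T : E) (t : Hom T Z) (V' : E) (p1' : Hom V' X) (p2' : Hom V' T)
           (e' : Hom V' A),
      is_pullback f t p1' p2' -> a ∘ e' = p1' ->
      exists! h : Hom T W, w ∘ h = t /\
        exists k : Hom V' V, p1 ∘ k = p1' /\ p2 ∘ k = h ∘ p2' /\ e ∘ k = e'.

Section Slices.
Variables (E : Category) (I : E).

Definition slice_mor (A B : slice I) (h : Hom (slice_dom A) (slice_dom B))
    (e : slice_arr B ∘ h = slice_arr A) : Hom A B := exist _ h e.

Arguments slice_mor {A B} & h e.

Lemma slice_hom_comm (A B : slice I) (h : Hom A B) :
  slice_arr B ∘ proj1_sig h = slice_arr A.
Proof. exact (proj2_sig h). Qed.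

Lemma slice_product_pullback (A B Q : slice I) (p1 : Hom Q A) (p2 : Hom Q B) :
  is_product p1 p2 ->
  is_pullback (slice_arr A) (slice_arr B) (proj1_sig p1) (proj1_sig p2).
Proof.
intros H.
assert (jm : forall T (u v : Hom T (slice_dom Q)),
  proj1_sig p1 ∘ u = proj1_sig p1 ∘ v ->
  proj1_sig p2 ∘ u = proj1_sig p2 ∘ v -> u = v).
{ intros T u v h1 h2.
  (* Both arrows lie over the same arrow to [I], so they can be compared in the slice. *)
  assert (e : slice_arr Q ∘ v = slice_arr Q ∘ u).
  { rewrite <- (slice_hom_comm p1); nrm; now rewrite h1. }
  pose (T' := MkSliceOb (slice_arr Q ∘ u) : slice I).
  pose (u' := slice_mor u eq_refl : @Hom (slice I) T' Q).
  pose (v' := slice_mor v e : @Hom (slice I) T' Q).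
  destruct (H T' (p1 ∘ v') (p2 ∘ v')) as [m [_ hm]].
  assert (hu : m = u') by (apply hm; split; apply slice_hom_eq; trivial).
  assert (hv : m = v') by (apply hm; split; apply slice_hom_eq; trivial).
  change (proj1_sig u' = proj1_sig v'); now rewrite <- hu, <- hv. }
apply pullback_intro; trivial.
- now rewrite !slice_hom_comm.
- intros T t1 t2 e.
  pose (T' := MkSliceOb (slice_arr A ∘ t1) : slice I).
  pose (s1 := slice_mor t1 eq_refl : @Hom (slice I) T' A).
  pose (s2 := slice_mor t2 (eq_sym e) : @Hom (slice I) T' B).
  destruct (H T' s1 s2) as [m [[h1 h2] _]].
  exists (proj1_sig m); split.
  + exact (f_equal (@proj1_sig _ _) h1).
  + exact (f_equal (@proj1_sig _ _) h2).
Qed.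

Lemma pullback_slice_product (A B Q : slice I) (p1 : Hom Q A) (p2 : Hom Q B) :
  is_pullback (slice_arr A) (slice_arr B) (proj1_sig p1) (proj1_sig p2) ->
  is_product p1 p2.
Proof.
intros pb T t1 t2.
destruct (@pullback_lift _ _ _ _ _ _ _ _ _ pb _ (proj1_sig t1) (proj1_sig t2))
  as [u [h1 h2]].
- now rewrite !slice_hom_comm.
- assert (hu : slice_arr Q ∘ u = slice_arr T).
  { rewrite <- (slice_hom_comm p1), <- (slice_hom_comm t1); nrm; now rewrite h1. }
  exists (slice_mor u hu : Hom T Q); split.
  + split; apply slice_hom_eq; trivial.
  + intros v [v1 v2]; apply slice_hom_eq; simpl.
    apply (pullback_ext pb); [rewrite h1|rewrite h2]; symmetry.
    * exact (f_equal (@proj1_sig _ _) v1).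
    * exact (f_equal (@proj1_sig _ _) v2).
Qed.

End Slices.

Arguments slice_mor {E I A B} & h e.

(** The exponential of [B] by [A] over [I] is the dependent product, along the arrow of [A], of the
    pullback [D] of [B] to [A]; evaluation is [d2 ∘ e]. *)
Lemma dependent_products_lcc (E : Category) (E_lim : has_finite_limits E) :
  has_dependent_products E -> locally_cartesian_closed E.
Proof.
intros dp I; split; [|split].
- pose (T := MkSliceOb (id I) : slice I); exists T; intros X.
  exists (slice_mor (slice_arr X) (comp_id_l _) : Hom X T); split; trivial.
  intros h _; apply slice_hom_eq; simpl.
  pose proof (slice_hom_comm h) as e; simpl in e; now rewrite comp_id_l in e.
- intros A B.
  destruct (pullback_exists E_lim (slice_arr A) (slice_arr B))
    as [V [p1 [p2 pb]]].
  pose (Q := MkSliceOb (slice_arr A ∘ p1) : slice I).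
  exists Q, (slice_mor p1 eq_refl : Hom Q A),
    (slice_mor p2 (eq_sym (pullback_comm pb)) : Hom Q B).
  now apply pullback_slice_product.
- intros A B.
  destruct (pullback_exists E_lim (slice_arr A) (slice_arr B))
    as [D [d1 [d2 Dpb]]].
  destruct (dp D (slice_dom A) I d1 (slice_arr A))
    as [W [w [V [p1 [p2 [e [pb [he univ]]]]]]]].
  pose (F := MkSliceOb w : slice I).
  pose (Q := MkSliceOb (w ∘ p2) : slice I).
  assert (h1 : slice_arr A ∘ p1 = w ∘ p2) by exact (pullback_comm pb).
  assert (h2 : slice_arr B ∘ (d2 ∘ e) = w ∘ p2).
  { rw (eq_sym (pullback_comm Dpb)), he; exact h1. }
  exists F, Q, (slice_mor p2 eq_refl : Hom Q F), (slice_mor p1 h1 : Hom Q A),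
    (slice_mor (d2 ∘ e) h2 : Hom Q B).
  split.
  + apply pullback_slice_product; simpl.
    apply pullback_intro; [now symmetry|..].
    * intros T t1 t2 ht.
      destruct (pullback_lift pb (eq_sym ht)) as [u [? ?]]; eauto.
    * intros T u v ? ?; now apply (pullback_ext pb).
  + intros T R q1 q2 hR g.
    pose proof (slice_product_pullback hR) as Rpb.
    destruct (@pullback_lift _ _ _ _ _ _ _ _ _ Dpb _ (proj1_sig q2) (proj1_sig g))
      as [e' [he1 he2]].
    { now rewrite !slice_hom_comm. }
    destruct (univ _ (slice_arr T) _ (proj1_sig q2) (proj1_sig q1) e')
      as [h [[hw [k [hk1 [hk2 hk3]]]] h_uniq]]; trivial.
    { apply pullback_intro.
      - symmetry; apply (pullback_comm Rpb).
      - intros S s1 s2 hs.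
        destruct (pullback_lift Rpb (eq_sym hs)) as [u [? ?]]; eauto.
      - intros S u v ? ?; now apply (pullback_ext Rpb). }
    assert (hk : slice_arr Q ∘ k = slice_arr R).
    { simpl; rw hk2, hw; apply slice_hom_comm. }
    exists (slice_mor h hw : Hom T F); split.
    * exists (slice_mor k hk : Hom R Q); split; [|split]; apply slice_hom_eq; simpl; trivial.
      nrm; now rewrite hk3.
    * intros h' [u [u1 [u2 u3]]]; apply slice_hom_eq; simpl.
      apply h_uniq; split; [exact (slice_hom_comm h')|].
      apply (f_equal (@proj1_sig _ _)) in u1, u2, u3; simpl in u1, u2, u3.
      exists (proj1_sig u); split; [exact u2|split; [exact u1|]].
      apply (pullback_ext Dpb).
      -- rw he, he1; exact u2.
      -- rewrite he2, comp_assoc; exact u3.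
Qed.

(** In the slice over [Z], sections of [a] are the maps from [X'] to [A'] whose composite with [a]
    is the identity. So [W] equalizes [h1], composition with [a], and [h2], constant at the
    identity. *)
Lemma lcc_dependent_products (E : Category) (E_lim : has_finite_limits E) :
  locally_cartesian_closed E -> has_dependent_products E.
Proof.
intros lcc A X Z a f.
destruct (lcc Z) as [_ [_ expo]].
pose (X' := MkSliceOb f : slice Z).
pose (A' := MkSliceOb (f ∘ a) : slice Z).
destruct (expo X' A') as [F [Q [q1 [q2 [ev [Qprod Funiv]]]]]].
destruct (expo X' X') as [G [R [r1 [r2 [ev' [Rprod Guniv]]]]]].
pose (a' := slice_mor a eq_refl : Hom A' X').
destruct (Guniv F Q q1 q2 Qprod (a' ∘ ev)) as [h1 [[u1 [u11 [u12 u13]]] _]].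
destruct (Guniv F Q q1 q2 Qprod q2) as [h2 [[u2 [u21 [u22 u23]]] _]].
destruct (equalizer_exists E_lim (proj1_sig h1) (proj1_sig h2))
  as [W [j [hj [j_monic j_univ]]]].
destruct (pullback_exists E_lim f (slice_arr F ∘ j)) as [V [p1 [p2 pb]]].
pose proof (slice_product_pullback Qprod) as Qpb.
pose proof (slice_product_pullback Rprod) as Rpb.
simpl in Qpb, Rpb.
destruct (@pullback_lift _ _ _ _ _ _ _ _ _ Qpb _ (j ∘ p2) p1) as [u [hu1 hu2]].
{ rw (pullback_comm pb); reflexivity. }
pose proof (f_equal (@proj1_sig _ _) u11) as c11.
pose proof (f_equal (@proj1_sig _ _) u12) as c12.
pose proof (f_equal (@proj1_sig _ _) u13) as c13.
pose proof (f_equal (@proj1_sig _ _) u21) as c21.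
pose proof (f_equal (@proj1_sig _ _) u22) as c22.
pose proof (f_equal (@proj1_sig _ _) u23) as c23.
simpl in c11, c12, c13, c21, c22, c23.
assert (uu : proj1_sig u1 ∘ u = proj1_sig u2 ∘ u).
{ apply (pullback_ext Rpb).
  - rw c11, c21, hu1; now rw hj.
  - now rw c12, c22. }
exists W, (slice_arr F ∘ j), V, p1, p2, (proj1_sig ev ∘ u).
split; [exact pb|split].
{ rw (eq_sym c13), uu, c23; exact hu2. }
intros T t V' p1' p2' e' pb' he'.
pose (T' := MkSliceOb t : slice Z).
pose (Q' := MkSliceOb (t ∘ p2') : slice Z).
pose (s1 := slice_mor p2' eq_refl : Hom Q' T').
pose (s2 := slice_mor p1' (pullback_comm pb') : Hom Q' X').
assert (Q'prod : is_product s1 s2).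
{ apply pullback_slice_product, pullback_intro; simpl.
  - symmetry; apply (pullback_comm pb').
  - intros S x y e; destruct (pullback_lift pb' (eq_sym e)) as [v [? ?]]; eauto.
  - intros S x y ? ?; now apply (pullback_ext pb'). }
assert (hg : (f ∘ a) ∘ e' = t ∘ p2').
{ rw he'; apply (pullback_comm pb'). }
pose (g := slice_mor e' hg : Hom Q' A').
destruct (Funiv T' Q' s1 s2 Q'prod g) as [h [[v [v1 [v2 v3]]] h_uniq]].
pose proof (f_equal (@proj1_sig _ _) v1) as d1.
pose proof (f_equal (@proj1_sig _ _) v2) as d2.
pose proof (f_equal (@proj1_sig _ _) v3) as d3.
simpl in d1, d2, d3.
(* Both sides are transposes of the projection [s2], as [e'] is a section. *)
assert (eqh : h1 ∘ h = h2 ∘ h).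
{ destruct (Guniv T' Q' s1 s2 Q'prod s2) as [m [_ hm]].
  transitivity m; [symmetry|]; apply hm.
  - exists (u1 ∘ v); split; [|split]; apply slice_hom_eq; simpl.
    + rw c11; now rw d1.
    + rw c12; exact d2.
    + rw c13, d3; exact he'.
  - exists (u2 ∘ v); split; [|split]; apply slice_hom_eq; simpl.
    + rw c21; now rw d1.
    + rw c22; exact d2.
    + rw c23; exact d2. }
destruct (j_univ _ (proj1_sig h)) as [l hl].
{ exact (f_equal (@proj1_sig _ _) eqh). }
assert (hw : slice_arr F ∘ j ∘ l = t).
{ rw hl; exact (slice_hom_comm h). }
exists l; split.
- split; [exact hw|].
  destruct (@pullback_lift _ _ _ _ _ _ _ _ _ pb _ p1' (l ∘ p2')) as [k [k1 k2]].
  { rw (pullback_comm pb'), (eq_sym hw); reflexivity. }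
  exists k; split; [exact k1|split; [exact k2|]].
  rewrite <- d3; nrm; f_equal; apply (pullback_ext Qpb).
  + rw hu1, k2, hl; now rewrite d1.
  + rw hu2, k1; now rewrite d2.
- intros l' [hw' [k [k1 [k2 k3]]]]; apply j_monic; transitivity (proj1_sig h); [exact hl|].
  assert (hl' : slice_arr F ∘ (j ∘ l') = slice_arr T').
  { now rewrite comp_assoc. }
  change (proj1_sig h = proj1_sig (slice_mor (j ∘ l') hl' : Hom T' F)); f_equal.
  apply h_uniq.
  assert (hk : slice_arr Q ∘ (u ∘ k) = slice_arr Q').
  { simpl; rewrite <- (slice_hom_comm q1); rw hu1, k2; now rw hw'. }
  exists (slice_mor (u ∘ k) hk : Hom Q' Q); split; [|split]; apply slice_hom_eq;
    simpl.
  + rw hu1; now rw k2.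
  + rw hu2; exact k1.
  + now rewrite comp_assoc.
Qed.

(** * Extensional dependent products in terms of points *)

Section FullSubcategory.
Variables (E : Category) (P : E -> Prop).
Hypotheses (E_lim : has_finite_limits E) (P_cover : projective_cover P).

Local Notation FP := (full_subcategory P).
Local Notation carrier := (@proj1_sig E P).

(** Weak pullbacks of the full subcategory, phrased in [E] so that they can be compared with its
    pullbacks. *)
Definition point_pullback (X W Z V : E) (f : Hom X Z) (w : Hom W Z)
    (p1 : Hom V X) (p2 : Hom V W) : Prop :=
  f ∘ p1 = w ∘ p2 /\
  forall T, P T -> forall (t1 : Hom T X) (t2 : Hom T W), f ∘ t1 = w ∘ t2 ->
    exists u : Hom T V, p1 ∘ u = t1 /\ p2 ∘ u = t2.

(** This comparison is what lets arrows defined on a weak pullback descend to the pullback. *)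
Lemma point_pullback_cover (X W Z V U : E) (f : Hom X Z) (w : Hom W Z)
    (p1 : Hom V X) (p2 : Hom V W) (u1 : Hom U X) (u2 : Hom U W) :
  point_pullback f w p1 p2 -> is_pullback f w u1 u2 ->
  exists s : Hom V U, u1 ∘ s = p1 /\ u2 ∘ s = p2 /\ cover P s.
Proof.
intros [pc pu] upb; destruct (pullback_lift upb pc) as [s [hs1 hs2]].
exists s; split; [exact hs1|split; [exact hs2|]].
intros T PT t; destruct (pu T PT (u1 ∘ t) (u2 ∘ t)) as [t' [h1 h2]].
- now rw (pullback_comm upb).
- exists t'; apply (pullback_ext upb).
  + now rw hs1.
  + now rw hs2.
Qed.

Definition point_preserves (X V W Y Y' : E) (p1 : Hom V X) (p2 : Hom V W)
    (y1 y2 : Hom Y' Y) (f : Hom V Y) : Prop :=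
  forall T, P T -> forall v1 v2 : Hom T V,
    p1 ∘ v1 = p1 ∘ v2 -> p2 ∘ v1 = p2 ∘ v2 -> related y1 y2 (f ∘ v1) (f ∘ v2).

Definition point_data (Y' Y X Z : E) (y1 y2 : Hom Y' Y) (g : Hom Y X)
    (f : Hom X Z) (W : E) (w : Hom W Z) (V : E) (p1 : Hom V X) (p2 : Hom V W)
    (e : Hom V Y) : Prop :=
  P W /\ P V /\ point_pullback f w p1 p2 /\ point_preserves p1 p2 y1 y2 e /\
  g ∘ e = p1.

Lemma full_weak_pullback (X W Z V : FP) (f : Hom X Z) (w : Hom W Z)
    (p1 : Hom V X) (p2 : Hom V W) :
  is_weak_pullback f w p1 p2 <->
  @point_pullback (carrier X) (carrier W) (carrier Z) (carrier V) f w p1 p2.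
Proof.
split; intros [e H]; split; try exact e.
- intros T PT t1 t2; exact (H (exist _ T PT) t1 t2).
- intros [T PT] t1 t2; exact (H T PT t1 t2).
Qed.

Lemma full_preserves (X V W Y Y' : FP) (p1 : Hom V X) (p2 : Hom V W)
    (y1 y2 : Hom Y' Y) (f : Hom V Y) :
  preserves_projections p1 p2 y1 y2 f <->
  @point_preserves (carrier X) (carrier V) (carrier W) (carrier Y) (carrier Y')
    p1 p2 y1 y2 f.
Proof.
destruct X as [X PX], V as [V PV], W as [W PW], Y as [Y PY], Y' as [Y' PY'];
  simpl in *; split.
- intros [[K PK] [v1 [v2 [[_ [_ U]] [f' [h1 h2]]]]]] T PT t1 t2 e1 e2.
  destruct (U (exist _ T PT) t1 t2 e1 e2) as [u [hu1 hu2]]; simpl in *.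
  exists (f' ∘ u); split.
  + rw h1; now rw hu1.
  + rw h2; now rw hu2.
- intros H.
  (* A cover of the kernel pair in [E] by an object of [P] is a weak kernel pair; its legs are the
     generic points to which [H] applies. *)
  destruct (span_kernel_exists E_lim p1 p2) as [K [k1 [k2 [e1 [e2 [_ U]]]]]].
  destruct (cover_exists P_cover K) as [K0 [c [PK0 hc]]].
  exists (exist _ K0 PK0), (k1 ∘ c), (k2 ∘ c); split; [split; [|split]|]; simpl.
  + now rw e1.
  + now rw e2.
  + intros [T PT] t1 t2 h1 h2; simpl in *.
    destruct (U T t1 t2 h1 h2) as [u [<- <-]].
    destruct (hc T PT u) as [u0 <-]; exists u0; now nrm.
  + apply H; trivial; nrm.
    * now rw e1.
    * now rw e2.
Qed.

(** The structure arrows come from the generic points: the identities of [X] and [R], and a cover of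
    the pullback for transitivity. *)
Lemma full_pseudo_equivalence (R X : FP) (r1 r2 : Hom R X) :
  pseudo_equivalence_relation r1 r2 <->
  @point_equivalence E P (carrier R) (carrier X) r1 r2.
Proof.
destruct R as [R PR], X as [X PX]; simpl in *; split.
- intros [[rho [rho1 rho2]] [[sigma [sigma1 sigma2]] H]] T PT.
  destruct H as [[W PW] [p1 [p2 [tau [[_ U] [tau1 tau2]]]]]]; simpl in *.
  split; [|split].
  + intros x; exists (rho ∘ x); split; cat.
  + intros x y [r [<- <-]]; exists (sigma ∘ r); split; cat.
  + intros x y z [r [<- <-]] [s [hs <-]].
    destruct (U (exist _ T PT) r s (eq_sym hs)) as [u [<- <-]]; simpl in *.
    exists (tau ∘ u); split; cat.
- intros H.
  destruct (H X PX) as [hr _], (H R PR) as [_ [hs _]].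
  split; [exact (hr (id X))|split; [|]].
  + apply hs; exists (id R); split; apply comp_id_r.
  + destruct (pullback_exists E_lim r2 r1) as [W [p1 [p2 pb]]].
    destruct (cover_exists P_cover W) as [W0 [c [PW0 hc]]].
    destruct (H W0 PW0) as [_ [_ ht]].
    destruct (ht (r1 ∘ p1 ∘ c) (r2 ∘ p1 ∘ c) (r2 ∘ p2 ∘ c)) as [tau [t1 t2]].
    * exists (p1 ∘ c); now nrm.
    * exists (p2 ∘ c); nrm; split; trivial; now rw (pullback_comm pb).
    * exists (exist _ W0 PW0), (p1 ∘ c), (p2 ∘ c), tau.
      split; [|nrm; rewrite <- ?comp_assoc in *; auto].
      apply full_weak_pullback; split; simpl.
      -- now rw (pullback_comm pb).
      -- intros T PT a b e; destruct (pullback_lift pb e) as [u [<- <-]].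
         destruct (hc T PT u) as [v <-]; exists v; now nrm.
Qed.

Definition has_point_edp : Prop :=
  forall (Y' Y X Z : E) (y1 y2 : Hom Y' Y) (g : Hom Y X) (f : Hom X Z),
  P Y' -> P Y -> P X -> P Z -> point_equivalence P y1 y2 -> g ∘ y1 = g ∘ y2 ->
  exists W w V p1 p2 e, @point_data Y' Y X Z y1 y2 g f W w V p1 p2 e /\
    forall W' w' V' p1' p2' e',
      @point_data Y' Y X Z y1 y2 g f W' w' V' p1' p2' e' ->
      exists (h : Hom W' W) (k : Hom V' V),
        w ∘ h = w' /\ p1 ∘ k = p1' /\ p2 ∘ k = h ∘ p2' /\ e ∘ k = e'.

Lemma full_edp : has_extensional_dependent_products FP <-> has_point_edp.
Proof.
split.
- intros H Y' Y X Z y1 y2 g f PY' PY PX PZ yeq gy.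
  destruct (H (exist _ Y' PY') (exist _ Y PY) (exist _ X PX) (exist _ Z PZ)
              y1 y2 g f) as [[[W PW] w [V PV] p1 p2 e pb pres sec] univ]; trivial.
  { apply full_pseudo_equivalence; exact yeq. }
  simpl in *; exists W, w, V, p1, p2, e; split.
  + repeat split; trivial.
    * exact (proj1 pb).
    * intros T PT; exact (proj2 pb (exist _ T PT)).
    * exact (proj1 (@full_preserves (exist _ X PX) (exist _ V PV) (exist _ W PW)
        (exist _ Y PY) (exist _ Y' PY') p1 p2 y1 y2 e) pres).
  + intros W' w' V' p1' p2' e' [PW' [PV' [pb' [pres' sec']]]].
    refine (univ (@MkEdpData FP (exist _ Y' PY') (exist _ Y PY) (exist _ X PX)
      (exist _ Z PZ) y1 y2 g f (exist _ W' PW') w' (exist _ V' PV') p1' p2' e'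
      _ _ sec')).
    * apply full_weak_pullback; exact pb'.
    * apply full_preserves; exact pres'.
- intros H [Y' PY'] [Y PY] [X PX] [Z PZ] y1 y2 g f yeq gy.
  apply full_pseudo_equivalence in yeq.
  destruct (H Y' Y X Z y1 y2 g f PY' PY PX PZ yeq gy)
    as [W [w [V [p1 [p2 [e [[PW [PV [pb [pres sec]]]] univ]]]]]]].
  unshelve eexists.
  { refine (@MkEdpData FP (exist _ Y' PY') (exist _ Y PY) (exist _ X PX)
      (exist _ Z PZ) y1 y2 g f (exist _ W PW) w (exist _ V PV) p1 p2 e _ _ sec).
    - apply full_weak_pullback; exact pb.
    - apply full_preserves; exact pres. }
  intros [[W' PW'] w' [V' PV'] p1' p2' e' pb' pres' sec']; simpl in *.
  apply univ; split; [exact PW'|split; [exact PV'|split; [|split]]].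
  + exact (proj1 (@full_weak_pullback (exist _ X PX) (exist _ W' PW')
      (exist _ Z PZ) (exist _ V' PV') f w' p1' p2') pb').
  + exact (proj1 (@full_preserves (exist _ X PX) (exist _ V' PV')
      (exist _ W' PW') (exist _ Y PY) (exist _ Y' PY') p1' p2' y1 y2 e') pres').
  + exact sec'.
Qed.

End FullSubcategory.

(** * Comparison of the two dependent products *)

Section Equivalence.
Variables (E : Category) (P : E -> Prop).
Hypotheses (E_exact : exact E) (P_cover : projective_cover P).

Let E_lim : has_finite_limits E := proj1 E_exact.

(** A point of [V2] is a point of the pullback of [f] and [w0 ∘ c] together with a representative in
    [Y] of its evaluation; so not only the class but the value of [e'] is remembered. *)
Lemma dependent_products_point_edp :
  has_dependent_products E -> has_point_edp P.
Proof.
intros dp Y' Y X Z y1 y2 g f PY' PY PX PZ yeq gy.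
destruct (quotient_exists E_exact P_cover yeq) as [A [q [hq qrel]]].
destruct (cover_descend P_cover (q := q) (t := g) hq) as [a ha].
{ intros T PT s t e; apply qrel in e; trivial.
  destruct e as [r [<- <-]]; now rw gy. }
destruct (dp A X Z a f) as [W0 [w0 [V0 [p10 [p20 [e0 [pb0 [ae0 univ]]]]]]]].
destruct (cover_exists P_cover W0) as [W [c [PW hc]]].
destruct (pullback_exists E_lim f (w0 ∘ c)) as [V1 [p11 [p21 pb1]]].
pose proof (pullback_comm pb1) as c1.
destruct (pullback_lift pb0 (t1 := p11) (t2 := c ∘ p21)) as [d [d1 d2]].
{ rw c1; reflexivity. }
destruct (pullback_exists E_lim (e0 ∘ d) q) as [V2 [s2 [y pb2]]].
pose proof (pullback_comm pb2) as c2.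
destruct (cover_exists P_cover V2) as [V [v [PV hv]]].
assert (sec : g ∘ (y ∘ v) = p11 ∘ s2 ∘ v).
{ rewrite <- ha; rw (eq_sym c2), ae0; now rw d1. }
exists W, (w0 ∘ c), V, (p11 ∘ s2 ∘ v), (p21 ∘ s2 ∘ v), (y ∘ v).
split; [split; [|split; [|split; [split|split]]]|]; trivial.
- now rw c1.
- intros T PT t1 t2 e.
  destruct (pullback_lift pb1 e) as [t [<- <-]].
  destruct (hq T PT (e0 ∘ d ∘ t)) as [yt hyt].
  destruct (pullback_lift pb2 (eq_sym hyt)) as [t' [<- _]].
  destruct (hv T PT t') as [t'' <-].
  exists t''; now nrm.
- intros T PT v1 v2 h1 h2; apply qrel; trivial.
  rw (eq_sym c2).
  assert (h : s2 ∘ v ∘ v1 = s2 ∘ v ∘ v2).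
  { apply (pullback_ext pb1); now rewrite !comp_assoc. }
  now rw h.
- intros W' w' V' p1' p2' e' [PW' [PV' [pb' [pres' sec']]]].
  destruct (pullback_exists E_lim f w') as [U [u1 [u2 upb]]].
  destruct (point_pullback_cover pb' upb) as [s [hs1 [hs2 hs]]].
  destruct pb' as [pb'c _].
  (* Since [e'] preserves projections, the class of its value depends only on the point of [U]. *)
  destruct (cover_descend P_cover (t := q ∘ e') hs) as [m hm].
  { intros T PT a1 a2 e; nrm; apply qrel, pres'; trivial.
    - rewrite <- hs1; now rw e.
    - rewrite <- hs2; now rw e. }
  assert (am : a ∘ m = u1).
  { apply (cover_epi P_cover hs); rw hm, ha, sec'; now symmetry. }
  destruct (univ W' w' U u1 u2 m upb am) as [h0 [[hh0 [k0 [k1 [k2 k3]]]] _]].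
  destruct (hc W' PW' h0) as [h hh].
  exists h.
  destruct (pullback_lift pb1 (t1 := p1') (t2 := h ∘ p2')) as [t [t1 t2]].
  { rw hh, hh0; exact pb'c. }
  assert (tk : d ∘ t = k0 ∘ s).
  { apply (pullback_ext pb0).
    - rw d1, k1, t1; now symmetry.
    - rw d2, k2, t2, hh; now rw hs2. }
  (* The representative chosen is [e'] itself, which gives [e ∘ k = e'] strictly. *)
  destruct (pullback_lift pb2 (t1 := t) (t2 := e')) as [t' [t1' t2']].
  { rw tk, k3; exact hm. }
  destruct (hv V' PV' t') as [k hk].
  exists k; split; [|split; [|split]].
  + rw hh; exact hh0.
  + rw hk, t1'; exact t1.
  + rw hk, t1'; exact t2.
  + rw hk; exact t2'.
Qed.


(** Only the test bases [T] are restricted to [P]; pullbacks and sections are those of [E]. Having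
    [W] in [P] lets it be the base of a further such product. *)
Definition has_weak_dependent_product (A X Z : E) (a : Hom A X) (f : Hom X Z) :
    Prop :=
  exists (W : E) (w : Hom W Z) (V : E) (p1 : Hom V X) (p2 : Hom V W)
         (e : Hom V A),
    P W /\ is_pullback f w p1 p2 /\ a ∘ e = p1 /\
    forall (T : E) (t : Hom T Z) (V' : E) (p1' : Hom V' X) (p2' : Hom V' T)
           (e' : Hom V' A),
      P T -> is_pullback f t p1' p2' -> a ∘ e' = p1' ->
      exists (h : Hom T W) (k : Hom V' V),
        w ∘ h = t /\ p1 ∘ k = p1' /\ p2 ∘ k = h ∘ p2' /\ e ∘ k = e'.

(** For a cover [Y] of [A] with a cover of its kernel pair as relation, preserving projections means
    that [q ∘ e] descends to the pullback in [E]. *)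
Lemma point_edp_weak_dependent_product :
  has_point_edp P -> forall (A X Z : E) (a : Hom A X) (f : Hom X Z),
  P X -> P Z -> has_weak_dependent_product a f.
Proof.
intros edp A X Z a f PX PZ.
destruct (cover_exists P_cover A) as [Y [q [PY hq]]].
destruct (span_kernel_exists E_lim q q) as [K [k1 [k2 [qk [_ [_ K_univ]]]]]].
destruct (cover_exists P_cover K) as [Y' [c [PY' hc]]].
assert (rel : forall T, P T -> forall x y : Hom T Y,
  related (k1 ∘ c) (k2 ∘ c) x y <-> q ∘ x = q ∘ y).
{ intros T PT x y; split.
  - intros [r [<- <-]]; now rw qk.
  - intros e; destruct (K_univ T x y e e) as [r [<- <-]].
    destruct (hc T PT r) as [r' <-]; exists r'; now nrm. }
destruct (edp Y' Y X Z (k1 ∘ c) (k2 ∘ c) (a ∘ q) f)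
  as [W [w [V [p1 [p2 [e [[PW [PV [pb [pres sec]]]] univ]]]]]]]; trivial.
{ intros T PT; split; [|split].
  - intros x; now apply rel.
  - intros x y; rewrite !rel; auto.
  - intros x y z; rewrite !rel; trivial; congruence. }
{ now rw qk. }
destruct (pullback_exists E_lim f w) as [U [u1 [u2 upb]]].
destruct (point_pullback_cover pb upb) as [s [hs1 [hs2 hs]]].
destruct (cover_descend P_cover (t := q ∘ e) hs) as [m hm].
{ intros T PT a1 a2 h; nrm; apply rel, pres; trivial.
  - rewrite <- hs1; now rw h.
  - rewrite <- hs2; now rw h. }
assert (am : a ∘ m = u1).
{ apply (cover_epi P_cover hs); rw hm, hs1; rewrite <- sec; now nrm. }
exists W, w, U, u1, u2, m; split; [exact PW|split; [exact upb|split; [exact am|]]].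
intros T t V' p1' p2' e' PT pb' ae'.
(* A section into [A] need not lift to [Y], but it does so over a cover of [V']. *)
destruct (pullback_exists E_lim e' q) as [V2 [s2 [y pb2]]].
destruct (cover_exists P_cover V2) as [V3 [v [PV3 hv]]].
assert (hs' : cover P (s2 ∘ v)).
{ apply cover_comp; trivial; intros S PS x.
  destruct (hq S PS (e' ∘ x)) as [b hb].
  destruct (pullback_lift pb2 (eq_sym hb)) as [z [hz _]]; eauto. }
destruct (univ T t V3 (p1' ∘ (s2 ∘ v)) (p2' ∘ (s2 ∘ v)) (y ∘ v))
  as [h [k [wh [pk1 [pk2 ek]]]]].
{ split; [exact PT|split; [exact PV3|split; [split|split]]].
  - now rw (pullback_comm pb').
  - intros S PS t1 t2 ht; destruct (pullback_lift pb' ht) as [x [<- <-]].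
    destruct (hs' S PS x) as [x' <-]; exists x'; now nrm.
  - intros S PS v1 v2 h1 h2; apply rel; trivial.
    assert (hx : s2 ∘ v ∘ v1 = s2 ∘ v ∘ v2).
    { apply (pullback_ext pb'); now rewrite !comp_assoc in *. }
    rw (eq_sym (pullback_comm pb2)); now rw hx.
  - rw (eq_sym (pullback_comm pb2)), ae'; reflexivity. }
destruct (pullback_lift upb (t1 := p1') (t2 := h ∘ p2')) as [k' [h1 h2]].
{ rw wh; exact (pullback_comm pb'). }
exists h, k'; split; [exact wh|split; [exact h1|split; [exact h2|]]].
apply (cover_epi P_cover hs').
assert (sk : k' ∘ (s2 ∘ v) = s ∘ k).
{ apply (pullback_ext upb).
  - rw hs1, h1, pk1; reflexivity.
  - rw hs2, h2, pk2; reflexivity. }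
rw sk, hm, ek; now rw (pullback_comm pb2).
Qed.

(** A base [T] in [P] factors through the cover [z], and by pasting of pullbacks sections over [T]
    are the same for [f] and [f0]. *)
Lemma weak_dependent_product_cover_base (A X Z Z0 : E) (a : Hom A X)
    (f : Hom X Z) (z : Hom Z0 Z) (X0 : E) (x : Hom X0 X) (f0 : Hom X0 Z0)
    (A0 : E) (a0 : Hom A0 X0) (b : Hom A0 A) :
  cover P z -> is_pullback f z x f0 -> is_pullback x a a0 b ->
  has_weak_dependent_product a0 f0 -> has_weak_dependent_product a f.
Proof.
intros hz pbX pbA [W [w [V [p1 [p2 [e [PW [pb [ae univ]]]]]]]]].
exists W, (z ∘ w), V, (x ∘ p1), p2, (b ∘ e); split; [exact PW|split; [|split]].
- apply pullback_intro.
  + rw (pullback_comm pbX); now rw (pullback_comm pb).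
  + intros T t1 t2 ht; rewrite <- comp_assoc in ht.
    destruct (pullback_lift pbX ht) as [s [<- hs]].
    destruct (pullback_lift pb hs) as [r [<- <-]].
    exists r; now nrm.
  + intros T u v h1 h2; apply (pullback_ext pb); trivial.
    apply (pullback_ext pbX); [now rewrite !comp_assoc|].
    rw (pullback_comm pb); now rw h2.
- rewrite <- ae; now rw (pullback_comm pbA).
- intros T t V' p1' p2' e' PT pb' ae'.
  destruct (hz T PT t) as [t0 <-].
  destruct (pullback_lift pbX (t1 := p1') (t2 := t0 ∘ p2')) as [r [r1 r2]].
  { rw (pullback_comm pb'); reflexivity. }
  destruct (pullback_lift pbA (t1 := r) (t2 := e')) as [e0 [e01 e02]].
  { now rewrite r1. }
  destruct (univ T t0 V' r p2' e0) as [h [k [wh [pk1 [pk2 ek]]]]]; trivial.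
  { apply pullback_intro; [exact r2|..].
    - intros S s1 s2 hs.
      destruct (pullback_lift pb' (t1 := x ∘ s1) (t2 := s2)) as [v [v1 v2]].
      { rw (pullback_comm pbX), hs; reflexivity. }
      exists v; split; trivial; apply (pullback_ext pbX).
      + now rw r1.
      + rw r2, v2; now symmetry.
    - intros S u v h1 h2; apply (pullback_ext pb'); trivial.
      rewrite <- r1; now rw h1. }
  exists h, k; split; [|split; [|split]]; trivial.
  + now rw wh.
  + now rw pk1.
  + now rw ek.
Qed.

(** Points of [W0] name sections over the cover [X0]. [K] consists of pairs in [X0] over one point
    of [X], with a common point of [W0]; [X1] covers it, and [M] is where both values agree. A
    section of [M] over [X1] thus witnesses descent to [X], and [W] carries such witnesses. *)
Lemma weak_dependent_product_cover_fibre
    (edp : forall (A X Z : E) (a : Hom A X) (f : Hom X Z),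
       P X -> P Z -> has_weak_dependent_product a f)
    (A X Z : E) (a : Hom A X) (f : Hom X Z) :
  P Z -> has_weak_dependent_product a f.
Proof.
intros PZ.
destruct (cover_exists P_cover X) as [X0 [c [PX0 hc]]].
destruct (pullback_exists E_lim c a) as [A0 [a0 [b pbA]]].
destruct (edp A0 X0 Z a0 (f ∘ c) PX0 PZ)
  as [W0 [w0 [V0 [q1 [q2 [e0 [PW0 [pb0 [ae0 univ0]]]]]]]]].
pose proof (pullback_comm pb0) as pbc0.
assert (am : a ∘ (b ∘ e0) = c ∘ q1).
{ rw (eq_sym (pullback_comm pbA)); now rw ae0. }
destruct (span_kernel_exists E_lim (c ∘ q1) q2)
  as [K [k1 [k2 [ck [qk [_ K_univ]]]]]].
destruct (cover_exists P_cover K) as [X1 [x [PX1 hx]]].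
destruct (equalizer_exists E_lim (b ∘ e0 ∘ k1 ∘ x) (b ∘ e0 ∘ k2 ∘ x))
  as [M [i [hi [_ M_univ]]]].
destruct (edp M X1 W0 i (q2 ∘ k1 ∘ x) PX1 PW0)
  as [W [w [V1 [r1 [r2 [e1 [PW [pb1 [ie1 univ1]]]]]]]]].
destruct (pullback_exists E_lim f (w0 ∘ w)) as [V [p1 [p2 pb]]].
destruct (pullback_exists E_lim q2 w) as [U [n0 [n pbU]]].
pose proof (pullback_comm pb) as pbc.
pose proof (pullback_comm pbU) as pbUc.
destruct (pullback_lift pb (t1 := c ∘ q1 ∘ n0) (t2 := n)) as [d [d1 d2]].
{ rw pbc0; now rw pbUc. }
assert (hd : cover P d).
{ intros T PT v; destruct (hc T PT (p1 ∘ v)) as [x0 hx0].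
  destruct (pullback_lift pb0 (t1 := x0) (t2 := w ∘ p2 ∘ v)) as [v0 [v01 v02]].
  { rw hx0, pbc; reflexivity. }
  destruct (pullback_lift pbU (t1 := v0) (t2 := p2 ∘ v)) as [u [u1 u2]].
  { now rw v02. }
  exists u; apply (pullback_ext pb).
  - rw d1, u1; now rw v01.
  - now rw d2. }
(* Two points of [U] with the same image in [V] give a point of [K]; lifted to [X1], it is put into
   [M] by the witness [e1]. *)
destruct (cover_descend P_cover (t := b ∘ e0 ∘ n0) hd) as [e he].
{ intros T PT u v huv.
  destruct (K_univ T (n0 ∘ u) (n0 ∘ v)) as [l [l1 l2]].
  { rewrite !comp_assoc; rewrite <- d1; now rw huv. }
  { rw pbUc; rewrite <- d2; now rw huv. }
  destruct (hx T PT l) as [y hy].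
  destruct (pullback_lift pb1 (t1 := y) (t2 := n ∘ u)) as [z [z1 z2]].
  { rw hy, l1; now rw pbUc. }
  rw (eq_sym l1), (eq_sym l2), (eq_sym hy), (eq_sym z1), (eq_sym ie1).
  now rw hi. }
exists W, (w0 ∘ w), V, p1, p2, e; split; [exact PW|split; [exact pb|split]].
{ apply (cover_epi P_cover hd); rw he, am; now rw d1. }
intros T t V' p1' p2' e' PT pb' ae'.
pose proof (pullback_comm pb') as pbc'.
destruct (pullback_exists E_lim (f ∘ c) t) as [V0' [q1' [q2' pb0']]].
pose proof (pullback_comm pb0') as pbc0'.
destruct (pullback_lift pb' (t1 := c ∘ q1') (t2 := q2')) as [j [j1 j2]].
{ rw pbc0'; reflexivity. }
destruct (pullback_lift pbA (t1 := q1') (t2 := e' ∘ j)) as [e0' [f1 f2]].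
{ rw ae'; now symmetry. }
destruct (univ0 T t V0' q1' q2' e0' PT pb0' f1)
  as [h0 [k0 [wh0 [k01 [k02 k03]]]]].
(* Over [h0] the value of the section is that of [e' ∘ j], which depends only on the points of [X]
   and [T]. *)
assert (key : forall S (v v' : Hom S V0) (s : Hom S T),
  c ∘ q1 ∘ v = c ∘ q1 ∘ v' -> q2 ∘ v = h0 ∘ s -> q2 ∘ v' = h0 ∘ s ->
  b ∘ e0 ∘ v = b ∘ e0 ∘ v').
{ assert (lift : forall S (v : Hom S V0) (s : Hom S T), q2 ∘ v = h0 ∘ s ->
    exists y : Hom S V0', q2' ∘ y = s /\ k0 ∘ y = v).
  { intros S v s hv.
    destruct (pullback_lift pb0' (t1 := q1 ∘ v) (t2 := s)) as [y [y1 y2]].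
    { rw pbc0, hv; now rw wh0. }
    exists y; split; trivial; apply (pullback_ext pb0).
    - now rw k01.
    - rw k02, y2; now symmetry. }
  intros S v v' s hvv hv hv'.
  destruct (lift S v s hv) as [y [y1 <-]], (lift S v' s hv') as [y' [y1' <-]].
  rw k03, f2.
  assert (jy : j ∘ y = j ∘ y').
  { apply (pullback_ext pb').
    - rw j1; rewrite <- k01; now rewrite !comp_assoc in *.
    - rw j2; congruence. }
  now rw jy. }
destruct (pullback_exists E_lim (q2 ∘ k1 ∘ x) h0) as [V1' [r1' [r2' pb1']]].
pose proof (pullback_comm pb1') as pbc1'.
(* By [key] the section named by [h0] is compatible; the resulting section of [M] yields a lift [h]
   of [h0] along [w]. *)
destruct (M_univ V1' r1') as [e1' he1'].
{ rewrite <- 2!comp_assoc, <- (comp_assoc _ k2), <- (comp_assoc _ _ r1').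
  apply key with r2'.
  - now rw ck.
  - now rewrite !comp_assoc in *.
  - rewrite <- pbc1'; now rw qk. }
destruct (univ1 T h0 V1' r1' r2' e1' PT pb1' he1') as [h [_ [wh _]]].
destruct (pullback_lift pb (t1 := p1') (t2 := h ∘ p2')) as [k [pk1 pk2]].
{ rw wh, wh0; exact pbc'. }
exists h, k; split; [|split; [|split]]; trivial.
{ rw wh; exact wh0. }
assert (hj : cover P j).
{ intros S PS v; destruct (hc S PS (p1' ∘ v)) as [x0 hx0].
  destruct (pullback_lift pb0' (t1 := x0) (t2 := p2' ∘ v)) as [y [y1 y2]].
  { rw hx0; now rw pbc'. }
  exists y; apply (pullback_ext pb').
  - rw j1; now rw y1.
  - now rw j2. }
(* On [V0'] both sides become [b ∘ e0 ∘ k0]. *)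
apply (cover_epi P_cover hj).
destruct (pullback_lift pbU (t1 := k0) (t2 := h ∘ q2')) as [u [u1 u2]].
{ rw k02, wh; reflexivity. }
assert (kj : k ∘ j = d ∘ u).
{ apply (pullback_ext pb).
  - rw pk1, j1, d1, u1; now rw k01.
  - rw pk2, j2, d2; now symmetry. }
rw kj, he, u1, k03; now rewrite f2.
Qed.

(** Uniqueness may fail because several points of [W] name one section. [W2] pairs points over the
    same base, [M] is where their sections agree, and [R] classifies the pairs agreeing on the whole
    fibre; [Q] is the quotient. *)
Lemma weak_dependent_products_dependent_products :
  (forall (A X Z : E) (a : Hom A X) (f : Hom X Z),
     has_weak_dependent_product a f) ->
  has_dependent_products E.
Proof.
intros wdp A X Z a f.
destruct (wdp A X Z a f) as [W [w [V [p1 [p2 [e [PW [pb [ae univ]]]]]]]]].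
pose proof (pullback_comm pb) as pbc.
destruct (pullback_exists E_lim w w) as [W2 [l1 [l2 pbW2]]].
pose proof (pullback_comm pbW2) as pbW2c.
destruct (pullback_exists E_lim f (w ∘ l1)) as [V2 [q1 [q2 pbV2]]].
pose proof (pullback_comm pbV2) as pbV2c.
destruct (pullback_lift pb (t1 := q1) (t2 := l1 ∘ q2)) as [j1 [j11 j12]].
{ rw pbV2c; reflexivity. }
destruct (pullback_lift pb (t1 := q1) (t2 := l2 ∘ q2)) as [j2 [j21 j22]].
{ rw pbV2c; now rw pbW2c. }
destruct (equalizer_exists E_lim (e ∘ j1) (e ∘ j2)) as [M [i [hi [_ M_univ]]]].
destruct (wdp M V2 W2 i q2)
  as [R [r [VR [s1 [s2 [eR [PR [pbR [ieR univR]]]]]]]]].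
assert (rel : forall T, P T -> forall h1 h2 : Hom T W,
  related (l1 ∘ r) (l2 ∘ r) h1 h2 <->
  w ∘ h1 = w ∘ h2 /\
  forall S (v1 v2 : Hom S V) (s : Hom S T), p1 ∘ v1 = p1 ∘ v2 ->
    p2 ∘ v1 = h1 ∘ s -> p2 ∘ v2 = h2 ∘ s -> e ∘ v1 = e ∘ v2).
{ intros T PT h1 h2; split.
  - intros [u [<- <-]]; split; [now rw pbW2c|].
    intros S v1 v2 s hp hv1 hv2.
    destruct (pullback_lift pbV2 (t1 := p1 ∘ v1) (t2 := r ∘ u ∘ s))
      as [y [y1 y2]].
    { rw pbc, hv1; reflexivity. }
    destruct (pullback_lift pbR (t1 := y) (t2 := u ∘ s)) as [z [z1 z2]].
    { now rw y2. }
    assert (E1 : v1 = j1 ∘ y).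
    { apply (pullback_ext pb); [now rw j11|].
      rw j12, y2, hv1; reflexivity. }
    assert (E2 : v2 = j2 ∘ y).
    { apply (pullback_ext pb); [now rw j21; rewrite y1|].
      rw j22, y2, hv2; reflexivity. }
    rewrite E1, E2, <- z1, <- ieR; now rw hi.
  - intros [hw he].
    destruct (pullback_lift pbW2 hw) as [t [<- <-]].
    (* Agreement at the generic point of the fibre [V'] gives the section of [M]. *)
    destruct (pullback_exists E_lim q2 t) as [V' [p1' [p2' pb']]].
    destruct (M_univ V' p1') as [e' he'].
    { nrm; apply he with p2'.
      - rw j11; now rw j21.
      - rw j12; now rw (pullback_comm pb').
      - rw j22; now rw (pullback_comm pb'). }
    destruct (univR T t V' p1' p2' e' PT pb' he') as [h [_ [rh _]]].
    exists h; split; now rw rh. }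
destruct (@quotient_exists E P E_exact P_cover R W (l1 ∘ r) (l2 ∘ r))
  as [Q [q [hq qrel]]].
{ intros T PT; split; [|split].
  - intros h; apply rel; trivial; split; trivial.
    intros S v1 v2 s h0 h1 h2; f_equal; apply (pullback_ext pb); congruence.
  - intros h1 h2; rewrite !rel by trivial; intros [hw he]; split; [congruence|].
    intros S v1 v2 s h0 hv1 hv2; symmetry; apply he with s; congruence.
  - intros h1 h2 h3; rewrite !rel by trivial; intros [hw he] [hw' he'].
    split; [congruence|]; intros S v1 v3 s h0 hv1 hv3.
    (* Transitivity passes through the point over [h2] with the same component in [X]. *)
    destruct (pullback_lift pb (t1 := p1 ∘ v1) (t2 := h2 ∘ s)) as [v2 [c1 c2]].
    { rw pbc, hv1; now rw hw. }
    transitivity (e ∘ v2); [apply he with s|apply he' with s]; congruence. }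
assert (qeq : forall T, P T -> forall h1 h2 : Hom T W,
  q ∘ h1 = q ∘ h2 <->
  w ∘ h1 = w ∘ h2 /\
  forall S (v1 v2 : Hom S V) (s : Hom S T), p1 ∘ v1 = p1 ∘ v2 ->
    p2 ∘ v1 = h1 ∘ s -> p2 ∘ v2 = h2 ∘ s -> e ∘ v1 = e ∘ v2).
{ intros T PT h1 h2; rewrite qrel by trivial; apply rel; trivial. }
destruct (cover_descend P_cover (t := w) hq) as [wQ hwQ].
{ intros T PT h1 h2 hh; now apply qeq in hh. }
destruct (pullback_exists E_lim f wQ) as [VQ [g1 [g2 pbQ]]].
pose proof (pullback_comm pbQ) as pbQc.
destruct (pullback_lift pbQ (t1 := p1) (t2 := q ∘ p2)) as [c [c1 c2]].
{ rw hwQ; exact pbc. }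
assert (hc : cover P c).
{ intros T PT v; destruct (hq T PT (g2 ∘ v)) as [h hh].
  destruct (pullback_lift pb (t1 := g1 ∘ v) (t2 := h)) as [u [u1 u2]].
  { rw pbQc, (eq_sym hh); now rw hwQ. }
  exists u; apply (pullback_ext pbQ).
  - now rw c1.
  - rw c2, u2; exact hh. }
(* Points of [V] identified in [VQ] lie over one point of [X] and over related points of [W], so
   their values agree. *)
destruct (cover_descend P_cover (t := e) hc) as [eQ heQ].
{ intros T PT v1 v2 hv.
  assert (hh : q ∘ (p2 ∘ v1) = q ∘ (p2 ∘ v2)).
  { rewrite !comp_assoc, <- c2; now rw hv. }
  apply qeq in hh; trivial; destruct hh as [_ hh].
  apply hh with (id T); rewrite ?comp_id_r; trivial.
  rewrite <- c1; now rw hv. }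
exists Q, wQ, VQ, g1, g2, eQ; split; [exact pbQ|split].
{ apply (cover_epi P_cover hc); rw heQ, ae; now symmetry. }
intros T t V' p1' p2' e' pb' ae'.
pose proof (pullback_comm pb') as pbc'.
destruct (cover_exists P_cover T) as [T0 [d [PT0 hd]]].
destruct (pullback_exists E_lim f (t ∘ d)) as [V0 [p10 [p20 pb0]]].
pose proof (pullback_comm pb0) as pbc0.
destruct (pullback_lift pb' (t1 := p10) (t2 := d ∘ p20)) as [b [b1 b2]].
{ rw pbc0; reflexivity. }
destruct (univ T0 (t ∘ d) V0 p10 p20 (e' ∘ b) PT0 pb0)
  as [h0 [k0 [wh0 [k01 [k02 k03]]]]].
{ rw ae'; exact b1. }
assert (lift : forall S (v : Hom S V) (s : Hom S T0), p2 ∘ v = h0 ∘ s ->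
  exists y : Hom S V0, p20 ∘ y = s /\ k0 ∘ y = v).
{ intros S v s hv.
  destruct (pullback_lift pb0 (t1 := p1 ∘ v) (t2 := s)) as [y [y1 y2]].
  { rw pbc, hv; now rw wh0. }
  exists y; split; trivial; apply (pullback_ext pb).
  - now rw k01.
  - rw k02, y2; now symmetry. }
(* [h0] itself need not descend from [T0] to [T], but points with equal image in [T] name the same
   restriction of [e']. *)
destruct (cover_descend P_cover (t := q ∘ h0) hd) as [h hh].
{ intros S PS a1 a2 ha; nrm; apply qeq; trivial; split.
  - rw wh0; now rw ha.
  - intros S' v1 v2 s hp hv1 hv2; rewrite <- comp_assoc in hv1, hv2.
    destruct (lift S' v1 (a1 ∘ s) hv1) as [y1 [z1 <-]].
    destruct (lift S' v2 (a2 ∘ s) hv2) as [y2 [z2 <-]].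
    assert (by12 : b ∘ y1 = b ∘ y2).
    { apply (pullback_ext pb').
      - rw b1; rewrite <- k01; now rewrite <- !comp_assoc.
      - rw b2, z1, z2; now rw ha. }
    rw k03; now rw by12. }
assert (wh : wQ ∘ h = t).
{ apply (cover_epi P_cover hd); rw hh, hwQ; exact wh0. }
destruct (pullback_lift pbQ (t1 := p1') (t2 := h ∘ p2')) as [k [k1 k2]].
{ rw wh; exact pbc'. }
assert (k3 : eQ ∘ k = e').
{ assert (hb : cover P b).
  { intros S PS v; destruct (hd S PS (p2' ∘ v)) as [x hx].
    destruct (pullback_lift pb0 (t1 := p1' ∘ v) (t2 := x)) as [y [y1 y2]].
    { rw hx; now rw pbc'. }
    exists y; apply (pullback_ext pb').
    - now rw b1.
    - rw b2, y2; exact hx. }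
  apply (cover_epi P_cover hb).
  assert (kb : k ∘ b = c ∘ k0).
  { apply (pullback_ext pbQ).
    - rw k1, b1, c1; now symmetry.
    - rw k2, b2, hh, c2; now rw k02. }
  rw kb, heQ; exact k03. }
exists h; split.
- split; [exact wh|exists k; auto].
- intros h' [wh' [k' [k1' [k2' k3']]]].
  apply (point_ext P_cover); intros S PS x.
  (* The lifts [y] and [y'] to [W] both name the restriction of [e'] along [x], so [q] identifies
     them. *)
  destruct (hq S PS (h ∘ x)) as [y hy], (hq S PS (h' ∘ x)) as [y' hy'].
  rewrite <- hy, <- hy'; apply qeq; trivial; split.
  { rewrite <- hwQ; rw hy, hy', wh'; now rw wh. }
  intros S' v v' s hp hv hv'.
  destruct (pullback_lift pb' (t1 := p1 ∘ v) (t2 := x ∘ s)) as [z [z1 z2]].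
  { rw pbc, hv; rewrite <- hwQ; rw hy; now rw wh. }
  assert (E1 : c ∘ v = k ∘ z).
  { apply (pullback_ext pbQ).
    - rw c1, k1; now symmetry.
    - rw c2, k2, hv, z2; now rw hy. }
  assert (E2 : c ∘ v' = k' ∘ z).
  { apply (pullback_ext pbQ).
    - rw c1, k1', z1; now symmetry.
    - rw c2, k2', hv', z2; now rw hy'. }
  rewrite <- heQ; rw E1, E2, k3'; now rw k3.
Qed.

Lemma point_edp_dependent_products :
  has_point_edp P -> has_dependent_products E.
Proof.
intros edp; apply weak_dependent_products_dependent_products.
intros A X Z a f.
destruct (cover_exists P_cover Z) as [Z0 [z [PZ0 hz]]].
destruct (pullback_exists E_lim f z) as [X0 [x [f0 pbX]]].
destruct (pullback_exists E_lim x a) as [A0 [a0 [b pbA]]].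
apply (weak_dependent_product_cover_base hz pbX pbA).
apply weak_dependent_product_cover_fibre; trivial.
exact (point_edp_weak_dependent_product edp).
Qed.

End Equivalence.

Theorem theorem3p6 (E : Category) (P : E -> Prop)
    (E_exact : exact E) (P_cover : projective_cover P) :
  locally_cartesian_closed E <->
  has_extensional_dependent_products (full_subcategory P).
Proof.
pose proof (proj1 E_exact) as E_lim.
rewrite (full_edp E_lim P_cover); split; intros H.
- now apply dependent_products_point_edp, lcc_dependent_products.
- now apply dependent_products_lcc, (point_edp_dependent_products E_exact P_cover).
Qed.
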